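(* Let $\psi : M^2 \to \mathbb{L}^4$ be a spacelike immersion with $\psi(M^2)\subset\Lambda$. Assume that $\eta$ is non-degenerate, and let $\widetilde\psi=-\eta:M^2\to\Lambda\subset\mathbb{L}^4$ be the conjugated surface. Then $\psi$ is totally umbilical if and only if $\widetilde{\psi}$ is totally umbilical.
   Context: $\mathbb{L}^4$ is $\mathbb{R}^4$ with coordinates $(x_0,x_1,x_2,x_3)$ and the Lorentzian metric $\langle\cdot,\cdot\rangle=-dx_0^2+dx_1^2+dx_2^2+dx_3^2$. The future lightcone is $\Lambda=\{v\in\mathbb{L}^4:\langle v,v\rangle=0,\ v_0>0\}$. Surfaces $M^2$ are smooth connected 2-manifolds without boundary. An immersion $\psi:M^2\to\mathbb{L}^4$ is spacelike if the induced metric (also denoted $\langle\cdot,\cdot\rangle$) is Riemannian. If $\psi(M^2)\subset\Lambda$, the position vector field $\psi$ is normal and lightlike, and $\eta$ denotes the unique normal vector field along $\psi$ with $\langle\eta,\eta\rangle=0$ and $\langle\psi,\eta\rangle=1$. The Weingarten operator $A_\eta$ is given by $\langle A_\eta X,Y\rangle=\langle \mathrm{II}(X,Y),\eta\rangle$, where $\mathrm{II}(X,Y)$ is the normal component of $\overline\nabla_X Y$ (with $\overline\nabla$ the flat connection of $\mathbb{L}^4$). The field $\eta$ is non-degenerate if $\det(A_\eta)\neq 0$ at every point of $M^2$; in this case $\widetilde\psi=-\eta$ is also a spacelike immersion into $\mathbb{L}^4$ with image in $\Lambda$, called the conjugated surface to $\psi$. A spacelike immersion is totally umbilical if its second fundamental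 form satisfies $\mathrm{II}(X,Y)=\langle X,Y\rangle\,\mathbf{H}$ for all tangent $X,Y$, where $\langle\cdot,\cdot\rangle$ is the metric induced by that immersion and $\mathbf{H}=\frac12\mathrm{tr}_{\langle\cdot,\cdot\rangle}\mathrm{II}$. *)

(* Defs.v *)
From HB Require Import structures.
From mathcomp Require Import all_boot all_order all_algebra.
From mathcomp Require Import all_classical all_reals all_analysis.
Import Order.TTheory GRing.Theory Num.Theory.
Import numFieldNormedType.Exports.

Set Implicit Arguments.
Unset Strict Implicit.
Unset Printing Implicit Defensive.

Local Open Scope classical_set_scope.
Local Open Scope ring_scope.

(* The maps are total; only their values on the open set U matter.  Requiring
   all directional derivatives to be C^k amounts to requiring the partial ones
   to be. *)
Fixpoint Ck_on {R : realType} {m n : nat} (k : nat) (U : set 'rV[R]_m)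
    (f : 'rV[R]_m -> 'rV[R]_n) : Prop :=
  match k with
  | 0%N => forall x, U x -> {for x, continuous f}
  | k'.+1 => (forall x, U x -> forall v, derivable f x v) /\
             (forall v, Ck_on k' U ('D_v f))
  end.

Definition smooth_on {R : realType} {m n : nat} (U : set 'rV[R]_m)
    (f : 'rV[R]_m -> 'rV[R]_n) : Prop :=
  forall k, Ck_on k U f.

(* A homeomorphism from an open set of M onto an open set of the plane, both
   directions being extended by arbitrary values outside of these sets. *)
Record chart (R : realType) (M : topologicalType) := Chart {
  chart_dom : set M;
  chart_img : set 'rV[R]_2;
  chart_map : M -> 'rV[R]_2;
  chart_inv : 'rV[R]_2 -> M;
  chart_dom_open : open chart_dom;
  chart_img_open : open chart_img;
  chart_map_img : forall p, chart_dom p -> chart_img (chart_map p);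
  chart_inv_dom : forall x, chart_img x -> chart_dom (chart_inv x);
  chart_mapK : forall p, chart_dom p -> chart_inv (chart_map p) = p;
  chart_invK : forall x, chart_img x -> chart_map (chart_inv x) = x;
  chart_map_cont : forall p, chart_dom p -> {for p, continuous chart_map};
  chart_inv_cont : forall x, chart_img x -> {for x, continuous chart_inv}
}.

Record smooth_surface (R : realType) := SmoothSurface {
  surface_space :> topologicalType;
  surface_hausdorff : hausdorff_space surface_space;
  surface_second_countable : @second_countable surface_space;
  surface_connected : connected [set: surface_space];
  atlas : set (chart R surface_space);
  atlas_cover : forall p, exists2 c, atlas c & chart_dom c p;
  atlas_compat : forall c d, atlas c -> atlas d ->
    smooth_on (chart_img c `&` chart_inv c @^-1` chart_dom d)
              (chart_map d \o chart_inv c)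
}.

Definition smooth_map {R : realType} (M : smooth_surface R)
    (psi : M -> 'rV[R]_4) : Prop :=
  forall c, atlas c -> smooth_on (chart_img c) (psi \o chart_inv c).

Definition lorentz {R : realType} (v w : 'rV[R]_4) : R :=
  - (v ord0 ord0 * w ord0 ord0)
  + \sum_(i < 3) v ord0 (lift ord0 i) * w ord0 (lift ord0 i).

Definition future_lightcone {R : realType} : set 'rV[R]_4 :=
  [set v | lorentz v v = 0 /\ 0 < v ord0 ord0].

(* In the local definitions below, f : 'rV_2 -> 'rV_4 is the expression
   psi \o chart_inv c of a map in a chart c, x is a point of chart_img c, and
   u, v : 'rV_2 are the coordinates in c of tangent vectors to M at the
   corresponding point; the image under d psi of the vector u is 'D_u f x. *)

Definition induced_metric {R : realType} (f : 'rV[R]_2 -> 'rV[R]_4)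
    (x u v : 'rV[R]_2) : R :=
  lorentz ('D_u f x) ('D_v f x).

Definition normal_at {R : realType} (f : 'rV[R]_2 -> 'rV[R]_4)
    (x : 'rV[R]_2) (n : 'rV[R]_4) : Prop :=
  forall u, lorentz n ('D_u f x) = 0.

(* The normal component is unique where the induced metric is Riemannian. *)
Definition normal_part {R : realType} (f : 'rV[R]_2 -> 'rV[R]_4)
    (x : 'rV[R]_2) (w : 'rV[R]_4) : 'rV[R]_4 :=
  xget 0 [set n | normal_at f x n /\ exists u, w = 'D_u f x + n].

(* The derivative of the field d psi (Y) along X, for the flat connection. *)
Definition flat_connection {R : realType} (f : 'rV[R]_2 -> 'rV[R]_4)
    (X Y : 'rV[R]_2 -> 'rV[R]_2) (x : 'rV[R]_2) : 'rV[R]_4 :=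
  'D_(X x) (fun y => 'D_(Y y) f y) x.

(* The normal component of flat_connection f X Y at x only depends on the
   values of X and Y at x, so u and v may be extended by the vector fields with
   constant coordinates. *)
Definition second_fundamental_form {R : realType}
    (f : 'rV[R]_2 -> 'rV[R]_4) (x u v : 'rV[R]_2) : 'rV[R]_4 :=
  normal_part f x (flat_connection f (fun=> u) (fun=> v) x).

(* The matrix, acting on row vectors of coordinates, of the Weingarten operator
   of the normal vector n; it is unique where the induced metric is
   Riemannian. *)
Definition weingarten {R : realType} (f : 'rV[R]_2 -> 'rV[R]_4)
    (x : 'rV[R]_2) (n : 'rV[R]_4) : 'M[R]_2 :=
  xget 0 [set A : 'M[R]_2 | forall u v,
    induced_metric f x (u *m A) v
    = lorentz (second_fundamental_form f x u v) n].

Definition gram {R : realType} (f : 'rV[R]_2 -> 'rV[R]_4)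
    (x : 'rV[R]_2) : 'M[R]_2 :=
  \matrix_(i, j) induced_metric f x (delta_mx 0 i) (delta_mx 0 j).

(* One half of g^{ij} II(e_i, e_j), summed over i and j. *)
Definition mean_curvature {R : realType} (f : 'rV[R]_2 -> 'rV[R]_4)
    (x : 'rV[R]_2) : 'rV[R]_4 :=
  2^-1 *: \sum_(i < 2) \sum_(j < 2) invmx (gram f x) i j *:
    second_fundamental_form f x (delta_mx 0 i) (delta_mx 0 j).

Definition immersion {R : realType} (M : smooth_surface R)
    (psi : M -> 'rV[R]_4) : Prop :=
  smooth_map psi /\
  forall c, atlas c -> forall x, chart_img c x ->
    forall u, 'D_u (psi \o chart_inv c) x = 0 -> u = 0.

Definition spacelike_immersion {R : realType} (M : smooth_surface R)
    (psi : M -> 'rV[R]_4) : Prop :=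
  immersion psi /\
  forall c, atlas c -> forall x, chart_img c x ->
    forall u, u != 0 -> 0 < induced_metric (psi \o chart_inv c) x u u.

Definition normal_vector_field {R : realType} (M : smooth_surface R)
    (psi eta : M -> 'rV[R]_4) : Prop :=
  smooth_map eta /\
  forall c, atlas c -> forall x, chart_img c x ->
    normal_at (psi \o chart_inv c) x (eta (chart_inv c x)).

(* For a spacelike immersion psi into the lightcone, there is exactly one such
   field eta. *)
Definition lightlike_transversal {R : realType} (M : smooth_surface R)
    (psi eta : M -> 'rV[R]_4) : Prop :=
  normal_vector_field psi eta /\
  forall p, lorentz (eta p) (eta p) = 0 /\ lorentz (psi p) (eta p) = 1.

Definition nondegenerate_field {R : realType} (M : smooth_surface R)
    (psi eta : M -> 'rV[R]_4) : Prop :=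
  forall c, atlas c -> forall x, chart_img c x ->
    \det (weingarten (psi \o chart_inv c) x (eta (chart_inv c x))) != 0.

Definition conjugated_surface {R : realType} (M : smooth_surface R)
    (eta : M -> 'rV[R]_4) : M -> 'rV[R]_4 :=
  fun p => - eta p.

Definition totally_umbilical {R : realType} (M : smooth_surface R)
    (psi : M -> 'rV[R]_4) : Prop :=
  spacelike_immersion psi /\
  forall c, atlas c -> forall x, chart_img c x -> forall u v,
    second_fundamental_form (psi \o chart_inv c) x u v
    = induced_metric (psi \o chart_inv c) x u v
        *: mean_curvature (psi \o chart_inv c) x.

(* Main.v *)
Require Import Defs.
From HB Require Import structures.
From mathcomp Require Import all_boot all_order all_algebra.
From mathcomp Require Import all_classical all_reals all_analysis.
Import Order.TTheory GRing.Theory Num.Theory.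
Import numFieldNormedType.Exports.
Local Open Scope classical_set_scope.
Local Open Scope ring_scope.

(** The equivalence holds point by point.  Fix a point and write g for the
    metric of psi there and A for the Weingarten operator of eta.

    Differentiating <psi, psi> = <eta, eta> = 0 and <psi, eta> = 1 shows that
    the derivatives of psi and eta are orthogonal to both psi and eta.  These
    two vectors together with the tangent plane span the whole space
    ([frame_decomposition]), so the normal plane is spanned by psi and eta, and
    the derivative of eta is tangent: d eta (u) = - d psi (A u).  Since A is
    invertible, the conjugated surface has the same tangent and normal planes,
    and its metric is g(A u, A v).  Expanding second derivatives in the null
    normal frame gives ([conjugate_at])

      II(u, v)  = g(A u, v) psi - g(u, v) eta,
      II~(u, v) = g(A u, A v) psi - g(A v, u) eta.

    The first is g(u, v) times a fixed vector exactly when A is a scalar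
    ([umbilical_scalar]), and the second is g(A u, A v) times a fixed vector
    exactly under the same condition ([conjugate_umbilical_scalar]).  Such a
    vector is automatically the mean curvature ([umbilical_mean_curvature]).

    The analytic input is the linearity of a directional derivative in its
    direction, which for maps with continuous directional derivatives follows
    from the mean value theorem ([is_deriveDv]). *)

(** * Directional derivatives of continuously differentiable maps *)

Section DirectionalDerivative.
Context {R : realType} {V : normedModType R}.
Implicit Types (h : V -> R) (x y u v : V).

Lemma is_derive_line {h y v} {s : R} :
  derivable h (s *: v + y) v ->
  is_derive s 1 (fun r : R => h (r *: v + y)) ('D_v h (s *: v + y)).
Proof.
move=> hd.
have E : (fun t : R =>
      t^-1 *: (((fun r : R => h (r *: v + y)) \o shift s) (t *: 1)
               - h (s *: v + y)))
    = (fun t : R =>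
      t^-1 *: ((h \o shift (s *: v + y)) (t *: v) - h (s *: v + y))).
  by apply/funext => t /=; rewrite [t%:A]mulr1 scalerDl addrA.
by apply: DeriveDef; rewrite /derivable /derive E.
Qed.

(** The restriction of h to the line through x in the direction a v is the
    restriction to the line in the direction v, precomposed with r |-> a r. *)
Lemma is_deriveZv {h x v} {a : R} :
  derivable h x v -> is_derive x (a *: v) h (a * 'D_v h x).
Proof.
move=> hd.
have line : is_derive (a * (0 : R)) 1 (fun r : R => h (r *: v + x) : R)
    ('D_v h x).
  have hd0 : derivable h ((0 : R) *: v + x) v by rewrite scale0r add0r.
  by have := is_derive_line hd0; rewrite scale0r add0r mulr0.
have scale : is_derive (0 : R) 1 (fun r : R => a * r) a.
  have := @is_deriveZ R R^o R^o id a 0 1 1 (is_derive_id _ _).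
  by rewrite [_ *: 1]mulr1.
have [c d] := @is_derive1_comp _ _ _ _ _ _ line scale.
have E : (fun t : R =>
      t^-1 *: ((((fun r : R => h (r *: v + x)) \o (fun r : R => a * r))
                \o shift 0) (t *: 1) - h ((a * 0) *: v + x)))
    = (fun t : R => t^-1 *: ((h \o shift x) (t *: (a *: v)) - h x)).
  apply/funext => t /=.
  by rewrite [t%:A]mulr1 addr0 mulr0 scale0r add0r scalerA mulrC.
move: c d; rewrite /derivable /derive /= in E *; rewrite E => c d.
by apply: DeriveDef => //; rewrite /derive d mulrC.
Qed.

(** The increment along t (u + v) is the increment along t u, followed by the
    one from x + t u along t v; the mean value theorem turns the latter into
    t times a value of the derivative along v at a point close to x. *)
Lemma is_deriveDv {h x u v} :
  derivable h x u -> (\forall y \near x, derivable h y v) ->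
  {for x, continuous ('D_v h)} ->
  is_derive x (u + v) h ('D_u h x + 'D_v h x).
Proof.
move=> hu hv cv.
suff L : (fun t : R => t^-1 *: ((h \o shift x) (t *: (u + v)) - h x)) @ 0^'
    --> 'D_u h x + 'D_v h x.
  apply: DeriveDef; first by apply/cvg_ex; eexists; exact: L.
  by apply/cvg_lim => //; exact: L.
pose q (t : R) := t^-1 *: (h (t *: v + (t *: u + x)) - h (t *: u + x)).
rewrite (_ : (fun t : R => _) =
  (fun t : R => t^-1 *: ((h \o shift x) (t *: u) - h x)) \+ q); last first.
  apply/funext => t; rewrite /q /= -scalerDr; congr (_ *: _).
  rewrite scalerDr [t *: u + t *: v]addrC -addrA.
  by rewrite addrC [RHS]addrC subrKA.
apply: cvgD; first exact: hu.
apply/cvgrPdist_le => e e0.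
have /cvgrPdist_le/(_ e e0) cve := cv.
have [d /= d0 hd] := (nbhs_ballP _ _).1 (filterI hv cve).
near=> t.
pose seg (s : R) := s *: (t *: v) + (t *: u + x).
have inball (s : R) : s \in `[0, 1] -> ball x d (seg s).
  rewrite in_itv /= => /andP[s0 s1].
  rewrite /seg -ball_normE /= addrA opprD addrCA subrr addr0 normrN.
  (* The summand 1 only keeps the denominator positive. *)
  have tlt : `|t| < d / (`|u| + `|v| + 1).
    by near: t; apply: dnbhs0_lt; rewrite divr_gt0.
  rewrite ltr_pdivlMr in tlt => //.
  apply: le_lt_trans tlt.
  rewrite (le_trans (ler_normD _ _))// !normrZ (ger0_norm s0).
  have sX := ler_piMl (mulr_ge0 (normr_ge0 t) (normr_ge0 v)) s1.
  by rewrite addrC !mulrDr mulr1 -addrA lerD2l (le_trans sX)// lerDl.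
have [c c01 E] : exists2 c, c \in `[0, 1] &
    h (seg 1) - h (seg 0) = t * 'D_v h (seg c) * (1 - 0).
  have dseg (s : R) : s \in `[0, 1] ->
      is_derive s 1 (h \o seg) (t * 'D_v h (seg s)).
    move=> s01; have [hs _] := hd _ (inball s s01).
    have D := is_deriveZv (a := t) hs.
    have D' : derivable h (seg s) (t *: v) := @ex_derive _ _ _ _ _ _ _ D.
    by have := is_derive_line D'; rewrite (@derive_val _ _ _ _ _ _ _ D); exact.
  apply: (MVT_segment ler01 (fun s s01 => dseg s (subset_itv_oo_cc s01))).
  apply: derivable_within_continuous => s s01.
  exact: (@ex_derive _ _ _ _ _ _ _ (dseg s s01)).
have t0 : t != 0 by near: t; exact: nbhs_dnbhs_neq.
move: E; rewrite /seg scale1r scale0r add0r subr0 mulr1 /q => ->.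
rewrite [_ *: _](mulrA t^-1) mulVf// mul1r.
by have [_] := hd _ (inball c c01).
Unshelve. all: by end_near.
Qed.

End DirectionalDerivative.

Section DifferentialMatrix.
Context {R : realType} {m n : nat}.
Implicit Types (U : set 'rV[R]_m) (f g : 'rV[R]_m -> 'rV[R]_n).

Lemma coord_derive {f} {y v : 'rV[R]_m} j :
  derivable f y v ->
  derivable (fun z => f z 0 j) y v /\ 'D_v (fun z => f z 0 j) y = 'D_v f y 0 j.
Proof.
move=> fd; split; first exact: (proj1 (derivable_mxP _ _ _) fd).
by rewrite (derive_mx fd) mxE.
Qed.

Lemma C1_deriveDv {U f} {x u v : 'rV[R]_m} :
  open U -> Ck_on 1 U f -> U x -> 'D_(u + v) f x = 'D_u f x + 'D_v f x.
Proof.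
move=> oU [fd fc] Ux.
have nU : \forall y \near x, U y by exact: open_nbhs_nbhs.
apply/rowP => j; rewrite mxE.
have [du eu] := coord_derive j (fd x Ux u).
have [dv ev] := coord_derive j (fd x Ux v).
have [_ euv] := coord_derive j (fd x Ux (u + v)).
have ndv : \forall y \near x, derivable (fun z => f z 0 j) y v.
  by apply: (filterS _ nU) => y Uy; exact: (coord_derive j (fd y Uy v)).1.
have cdv : {for x, continuous ('D_v (fun z => f z 0 j))}.
  have c : (fun y => 'D_v f y 0 j) @ x --> 'D_v f x 0 j.
    apply: (continuous_comp (f := 'D_v f) (g := fun M : 'rV[R]_n => M 0 j)).
      exact: fc.
    exact: coord_continuous.
  rewrite /prop_for /continuous_at ev; apply: cvg_trans c.
  apply: (@near_eq_cvg _ _ (nbhs x)); apply: (filterS _ nU) => y Uy.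
  exact: esym (coord_derive j (fd y Uy v)).2.
apply: etrans (esym euv) (etrans _ (f_equal2 +%R eu ev)).
exact: (@derive_val _ _ _ _ _ _ _ (is_deriveDv du ndv cdv)).
Qed.

Lemma C1_deriveZv {U f} {x v : 'rV[R]_m} a :
  Ck_on 1 U f -> U x -> 'D_(a *: v) f x = a *: 'D_v f x.
Proof.
move=> [fd _] Ux; apply/rowP => j; rewrite mxE.
have [dv ev] := coord_derive j (fd x Ux v).
have [_ eav] := coord_derive j (fd x Ux (a *: v)).
apply: etrans (esym eav) (etrans _ (congr1 ( *%R a) ev)).
exact: (@derive_val _ _ _ _ _ _ _ (is_deriveZv dv)).
Qed.

Lemma C1_differential {U f} {x : 'rV[R]_m} :
  open U -> Ck_on 1 U f -> U x ->
  exists D : 'M[R]_(m, n), forall u, 'D_u f x = u *m D.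
Proof.
move=> oU fC Ux; exists (\matrix_i 'D_(delta_mx 0 i) f x) => u.
rewrite mulmx_sum_row {1}[u]row_sum_delta.
rewrite (big_morph (fun v => 'D_v f x) (fun u v => C1_deriveDv oU fC Ux)
  (derive0 _ _)).
by apply: eq_bigr => i _; rewrite rowK (C1_deriveZv _ fC Ux).
Qed.

(** The derivatives in [Ck_on] are functions on the whole space, and those of g
    and f may differ outside of U; the induction only compares them on U. *)
Lemma Ck_on_eq k U f g :
  open U -> (forall x, U x -> f x = g x) -> Ck_on k U f -> Ck_on k U g.
Proof.
move=> oU.
have nU x : U x -> \forall y \near x, U y by move=> Ux; exact: open_nbhs_nbhs.
elim: k f g => [|k IH] f g fg /=.
  move=> fc x Ux; rewrite /prop_for /continuous_at -fg//.
  apply: cvg_trans (fc x Ux); apply: (@near_eq_cvg _ _ (nbhs x)).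
  by apply: filterS (nU x Ux) => y /fg.
have nfg x : U x -> \forall y \near x, f y = g y.
  by move=> Ux; apply: filterS (nU x Ux) => y /fg.
move=> [fd fC]; split=> [x Ux v|v].
  by apply: near_eq_derivable (fd x Ux v); exact: nfg.
by apply: IH (fC v) => x Ux; apply: near_eq_derive; exact: nfg.
Qed.

Lemma Ck_onN k U f : open U -> Ck_on k U f -> Ck_on k U (fun x => - f x).
Proof.
move=> oU; elim: k f => [|k IH] f /=.
  by move=> fc x Ux; exact: (continuousN (fc x Ux)).
move=> [fd fC]; split=> [x Ux v|v].
  by apply: derivableN; exact: fd.
apply: Ck_on_eq (IH _ (fC v)) => // x Ux.
by rewrite deriveN//; exact: fd.
Qed.

End DifferentialMatrix.

(** * The Lorentzian product *)

Section Lorentz.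
Context {R : realType}.
Implicit Types (a : R) (u v w : 'rV[R]_4).

Lemma lorentzC v w : lorentz v w = lorentz w v.
Proof.
by rewrite /lorentz mulrC; congr (_ + _); apply: eq_bigr => i _; rewrite mulrC.
Qed.

Lemma lorentzDl u v w : lorentz (u + v) w = lorentz u w + lorentz v w.
Proof.
rewrite /lorentz mxE mulrDl opprD addrACA -big_split /=; congr (_ + _).
by apply: eq_bigr => i _; rewrite mxE mulrDl.
Qed.

Lemma lorentzZl a v w : lorentz (a *: v) w = a * lorentz v w.
Proof.
rewrite /lorentz mxE mulrDr mulrN mulrA mulr_sumr; congr (_ + _).
by apply: eq_bigr => i _; rewrite mxE mulrA.
Qed.

Lemma lorentzNl v w : lorentz (- v) w = - lorentz v w.
Proof. by rewrite -scaleN1r lorentzZl mulN1r. Qed.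

Lemma lorentz0l w : lorentz 0 w = 0.
Proof. by rewrite -(scale0r 0) lorentzZl mul0r. Qed.

Lemma lorentzZr a v w : lorentz v (a *: w) = a * lorentz v w.
Proof. by rewrite lorentzC lorentzZl lorentzC. Qed.

Lemma lorentzNr v w : lorentz v (- w) = - lorentz v w.
Proof. by rewrite lorentzC lorentzNl lorentzC. Qed.

Lemma lorentz_suml (I : finType) (F : I -> 'rV[R]_4) w :
  lorentz (\sum_i F i) w = \sum_i lorentz (F i) w.
Proof.
exact: (big_morph (fun z => lorentz z w) (fun y z => lorentzDl y z w)
  (lorentz0l w)).
Qed.

Lemma derive_lorentz {V : normedModType R} {a b : V -> 'rV[R]_4} {x u : V} :
  derivable a x u -> derivable b x u ->
  'D_u (fun y => lorentz (a y) (b y)) x =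
    lorentz ('D_u a x) (b x) + lorentz (a x) ('D_u b x).
Proof.
move=> da db.
have ha j : derivable (fun y => a y 0 j) x u :=
  proj1 (derivable_mxP _ _ _) da 0 j.
have hb j : derivable (fun y => b y 0 j) x u :=
  proj1 (derivable_mxP _ _ _) db 0 j.
have D j : is_derive x u (fun y => a y 0 j * b y 0 j)
    ('D_u a x 0 j * b x 0 j + a x 0 j * 'D_u b x 0 j).
  have := is_deriveM (derivableP (ha j)) (derivableP (hb j)).
  by rewrite (derive_mx da) (derive_mx db) !mxE addrC [_ *: _]mulrC; exact.
have E : (fun y => lorentz (a y) (b y)) =
    - (fun y => a y 0 0 * b y 0 0)
    + \sum_(i < 3) (fun y => a y 0 (lift ord0 i) * b y 0 (lift ord0 i)).
  by apply/funext => y; rewrite /lorentz !fctE fct_sumE.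
have DE := is_deriveD (is_deriveN (D 0))
  (is_derive_sum (fun i : 'I_3 => D (lift ord0 i))).
rewrite E (@derive_val _ _ _ _ _ _ _ DE) /lorentz big_split /= opprD.
exact: addrACA.
Qed.

Lemma derive_lorentz_cst {V : normedModType R} {U : set V}
    {a b : V -> 'rV[R]_4} {r : R} {x u : V} :
  open U -> U x -> (forall y, U y -> lorentz (a y) (b y) = r) ->
  derivable a x u -> derivable b x u ->
  lorentz ('D_u a x) (b x) = - lorentz (a x) ('D_u b x).
Proof.
move=> oU Ux abr da db; apply/eqP; rewrite -addr_eq0 -(derive_lorentz da db).
rewrite (@near_eq_derive _ _ _ _ (cst r)) ?derive_cst//.
by apply: (filterS _ (open_nbhs_nbhs (conj oU Ux))) => y /abr.
Qed.

Lemma lorentz_derive_null {V : normedModType R} {U : set V}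
    {a : V -> 'rV[R]_4} {x u : V} :
  open U -> U x -> (forall y, U y -> lorentz (a y) (a y) = 0) ->
  derivable a x u -> lorentz (a x) ('D_u a x) = 0.
Proof.
move=> oU Ux a0 da; have := derive_lorentz_cst oU Ux a0 da da.
by rewrite lorentzC => /eqP; rewrite -addr_eq0 -mulr2n mulrn_eq0 => /eqP.
Qed.

End Lorentz.

(** * Null normal frames of a spacelike plane *)

(** The row space of D is the tangent plane, a vector of coordinates u standing
    for the tangent vector u *m D, and p, e is a null frame of its normal
    plane. *)
Record null_frame {R : realType} (p e : 'rV[R]_4) (D : 'M[R]_(2, 4)) :=
  NullFrame {
    frame_pp : lorentz p p = 0;
    frame_ee : lorentz e e = 0;
    frame_pe : lorentz p e = 1;
    frame_pD : forall u, lorentz p (u *m D) = 0;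
    frame_eD : forall u, lorentz e (u *m D) = 0;
    frame_pos : forall u, u != 0 -> 0 < lorentz (u *m D) (u *m D)
  }.
Arguments frame_pp {R p e D}.
Arguments frame_ee {R p e D}.
Arguments frame_pe {R p e D}.
Arguments frame_pD {R p e D}.
Arguments frame_eD {R p e D}.
Arguments frame_pos {R p e D}.

Section NullFrame.
Context {R : realType}.
Implicit Types (p e w k : 'rV[R]_4) (D : 'M[R]_(2, 4)) (A : 'M[R]_2).
Implicit Types (u v x : 'rV[R]_2) (f : 'rV[R]_2 -> 'rV[R]_4).

Lemma frame_nondegenerate {p e D u} : null_frame p e D ->
  (forall v, lorentz (u *m D) (v *m D) = 0) -> u = 0.
Proof.
move=> F u0; apply/eqP/negPn/negP => /(frame_pos F).
by rewrite u0 ltxx.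
Qed.

(** The matrix with rows p, e and those of D is square, so it suffices that its
    rows are independent; pairing a linear relation with e, p and the tangent
    plane shows in turn that each of its coefficients vanishes. *)
Lemma frame_decomposition {p e D} w : null_frame p e D ->
  exists u, w = u *m D + (lorentz w e *: p + lorentz w p *: e).
Proof.
move=> F; pose P : 'M[R]_(1 + (1 + 2), 4) := col_mx p (col_mx e D).
have PE (v : 'rV_(1 + (1 + 2))) : exists a b u,
    v *m P = a *: p + (b *: e + u *m D) /\
    (a = 0 -> b = 0 -> u = 0 -> v = 0).
  have := hsubmxK v; set a := lsubmx _; set v' := rsubmx _ => vE.
  have := hsubmxK v'; set b := lsubmx _; set u := rsubmx _ => v'E.
  exists (a 0 0), (b 0 0), u; split.
    rewrite -vE -v'E !mul_row_col {1}[a]mx11_scalar {1}[b]mx11_scalar.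
    by rewrite !mul_scalar_mx.
  move=> a0 b0 u0; rewrite -vE -v'E [a]mx11_scalar [b]mx11_scalar a0 b0 u0.
  by rewrite !raddf0 !row_mx0.
have pairing a b u : let z := a *: p + (b *: e + u *m D) in
    lorentz z p = b /\ lorentz z e = a.
  rewrite /= !lorentzDl !lorentzZl !(lorentzC (_ *m D)).
  rewrite (frame_pD F) (frame_eD F) (lorentzC e p).
  rewrite (frame_pp F) (frame_ee F) (frame_pe F).
  by rewrite !mulr0 !mulr1 !addr0 add0r.
have : row_full P.
  rewrite -[row_full P]/(row_free P) -kermx_eq0.
  apply/rowV0P => v /sub_kermxP.
  have [a [b [u [-> vz]]]] := PE v => x0.
  have [b0 a0] := pairing a b u; rewrite x0 !lorentz0l in b0 a0.
  apply: vz => //; apply: (frame_nondegenerate F) => v'.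
  by move: x0; rewrite -a0 -b0 !scale0r !add0r => ->; rewrite lorentz0l.
move=> /(submx_full w)/submxP[c wE].
have [a [b [u [cE _]]]] := PE c.
exists u; have [] := pairing a b u; rewrite wE cE /= => -> ->.
by rewrite addrA addrC.
Qed.

Lemma frame_mulmx {p e D A} :
  A \in unitmx -> null_frame p e D -> null_frame p e (A *m D).
Proof.
move=> Au F; split; [exact: frame_pp F|exact: frame_ee F|exact: frame_pe F|..].
- by move=> u; rewrite mulmxA (frame_pD F).
- by move=> u; rewrite mulmxA (frame_eD F).
move=> u u0; rewrite mulmxA; apply: (frame_pos F).
by apply: contraNneq u0 => uA0; rewrite -(mulmxK Au u) uA0 mul0mx.
Qed.

Lemma normal_part_frame {f x p e D} w :
  (forall u, 'D_u f x = u *m D) -> null_frame p e D ->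
  normal_part f x w = lorentz w e *: p + lorentz w p *: e.
Proof.
move=> fD F; have [u wE] := frame_decomposition w F.
set n := lorentz w e *: p + _ in wE *; apply: xget_unique.
  split; last by exists u; rewrite fD.
  move=> v; rewrite fD lorentzDl !lorentzZl (frame_pD F) (frame_eD F).
  by rewrite !mulr0 addr0.
(* The difference of two normal parts is both tangent and normal. *)
move=> n' [nn [u']]; rewrite fD wE => E.
have n'E : n' = n + (u - u') *m D.
  rewrite -[LHS](addKr (u' *m D)) -E mulmxBl addrA [LHS]addrC.
  by congr (_ + _); exact: addrC.
rewrite n'E (@frame_nondegenerate p e D (u - u')) ?mul0mx ?addr0// => v.
have := nn v; rewrite n'E fD lorentzDl /n lorentzDl !lorentzZl.
by rewrite (frame_pD F) (frame_eD F) !mulr0 !add0r.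
Qed.

Lemma gramE {f x D} i j :
  (forall u, 'D_u f x = u *m D) -> gram f x i j = lorentz (row i D) (row j D).
Proof. by move=> fD; rewrite mxE /induced_metric !fD -!rowE. Qed.

Lemma gram_unitmx {f x p e D} :
  (forall u, 'D_u f x = u *m D) -> null_frame p e D -> gram f x \in unitmx.
Proof.
move=> fD F; rewrite -row_free_unit -kermx_eq0.
apply/rowV0P => u /sub_kermxP uG.
apply: (frame_nondegenerate F) => v.
rewrite (mulmx_sum_row v) lorentzC lorentz_suml big1// => j _.
rewrite lorentzZl lorentzC (mulmx_sum_row u) lorentz_suml.
have /(congr1 (fun M : 'rV_2 => M 0 j)) := uG; rewrite mxE [RHS]mxE => uGj.
under eq_bigr => i _ do rewrite lorentzZl -(gramE _ _ fD).
by rewrite uGj mulr0.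
Qed.

(** * Umbilical points of a surface and of its conjugate *)

(** The trace of g with respect to itself is the dimension 2, which the factor
    one half in the mean curvature cancels. *)
Lemma umbilical_mean_curvature {f x p e D} :
  (forall u, 'D_u f x = u *m D) -> null_frame p e D ->
  (forall u v, second_fundamental_form f x u v
     = induced_metric f x u v *: mean_curvature f x) <->
  exists k, forall u v,
    second_fundamental_form f x u v = induced_metric f x u v *: k.
Proof.
move=> fD F; split=> [fH|[k fk]]; first by exists (mean_curvature f x).
suff -> : mean_curvature f x = k by [].
have GV : \sum_i \sum_j invmx (gram f x) i j * gram f x j i = 2.
  rewrite -[RHS](mxtrace1 _ 2) -(mulVmx (gram_unitmx fD F)).
  by apply: eq_bigr => i _; rewrite mxE.
transitivity (2^-1 *: (2 *: k)); last first.
  by rewrite scalerA mulVf ?scale1r// pnatr_eq0.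
congr (_ *: _); rewrite -GV scaler_suml; apply: eq_bigr => i _.
rewrite scaler_suml; apply: eq_bigr => j _.
by rewrite fk scalerA !(gramE _ _ fD) /induced_metric !fD -!rowE lorentzC.
Qed.

Let delta_neq0 : delta_mx 0 0 != 0 :> 'rV[R]_2.
Proof.
by apply/eqP => /rowP/(_ 0); rewrite !mxE eqxx => /eqP; rewrite oner_eq0.
Qed.

(** With II(u, v) = g(A u, v) p - g(u, v) e, pairing the umbilicity equation
    with e leaves g(A u, v) = <k, e> g(u, v), so that A = <k, e>. *)
Lemma umbilical_scalar {p e D A} :
  A \in unitmx -> null_frame p e D ->
  (exists k, forall u v,
     lorentz (u *m A *m D) (v *m D) *: p - lorentz (u *m D) (v *m D) *: e
     = lorentz (u *m D) (v *m D) *: k) <->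
  (exists2 a, a != 0 & forall u, u *m A = a *: u).
Proof.
move=> Au F; split=> [[k Hk]|[a a0 Aa]]; last first.
  exists (a *: p - e) => u v.
  by rewrite Aa -scalemxAl lorentzZl scalerBr scalerA mulrC.
have Aa u : u *m A = lorentz k e *: u.
  apply/eqP; rewrite -subr_eq0; apply/eqP.
  apply: (frame_nondegenerate F) => v.
  have := congr1 (lorentz^~ e) (Hk u v).
  rewrite /= lorentzDl lorentzNl !lorentzZl (frame_pe F) (frame_ee F).
  rewrite mulr0 subr0 mulr1 => E.
  by rewrite mulmxBl -scalemxAl lorentzDl lorentzNl lorentzZl E mulrC subrr.
exists (lorentz k e) => //; apply: contraNneq delta_neq0 => a0.
by rewrite -(mulmxK Au (delta_mx 0 0)) Aa a0 scale0r mul0mx.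
Qed.

(** With II~(u, v) = g(A u, A v) p - g(A v, u) e, pairing the umbilicity
    equation with p leaves - g(A v, u) = <k, p> g(A v, A u), so that the
    inverse of A is - <k, p>. *)
Lemma conjugate_umbilical_scalar {p e D A} :
  A \in unitmx -> null_frame p e D ->
  (exists k, forall u v,
     lorentz (u *m A *m D) (v *m A *m D) *: p
       - lorentz (v *m A *m D) (u *m D) *: e
     = lorentz (u *m A *m D) (v *m A *m D) *: k) <->
  (exists2 a, a != 0 & forall u, u *m A = a *: u).
Proof.
move=> Au F; split=> [[k Hk]|[a a0 Aa]]; last first.
  exists (p - a^-1 *: e) => u v.
  rewrite scalerBr scalerA; congr (_ - _ *: _).
  rewrite (lorentzC (v *m A *m D)) !Aa -!scalemxAl !lorentzZl !lorentzZr.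
  by rewrite [RHS]mulrC mulKf.
have B u : u = - lorentz k p *: (u *m A).
  apply/eqP; rewrite -subr_eq0 scaleNr opprK; apply/eqP.
  apply: (frame_nondegenerate F) => v.
  have := congr1 (lorentz^~ p) (Hk u (v *m invmx A)).
  rewrite /= lorentzDl lorentzNl !lorentzZl (lorentzC e) (frame_pe F).
  rewrite (frame_pp F) mulr0 sub0r mulr1 (mulmxKV Au) => E.
  by rewrite mulmxDl -scalemxAl lorentzDl lorentzZl lorentzC mulrC -E addrN.
have k0 : - lorentz k p != 0.
  by apply: contraNneq delta_neq0 => k0; rewrite [delta_mx 0 0]B k0 scale0r.
exists (- lorentz k p)^-1; first by rewrite invr_eq0.
by move=> u; rewrite {2}[u]B scalerA mulVf// scale1r.
Qed.

(** The components of a second derivative along f and e are obtained by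
    differentiating the relations that make first derivatives orthogonal to f
    and e.  Applied to <D_v f, e> = 0, this also gives
    <D_u e, D_v f> = - <II(u, v), e>, which identifies the derivative of e with
    minus the Weingarten operator. *)
Lemma conjugate_at {U : set 'rV[R]_2} {f} {e : 'rV[R]_2 -> 'rV[R]_4} {x} :
  open U -> U x -> smooth_on U f -> smooth_on U e ->
  (forall y, U y -> lorentz (f y) (f y) = 0) ->
  (forall y, U y -> lorentz (e y) (e y) = 0) ->
  (forall y, U y -> lorentz (f y) (e y) = 1) ->
  (forall y, U y -> normal_at f y (e y)) ->
  (forall u, u != 0 -> 0 < induced_metric f x u u) ->
  \det (weingarten f x (e x)) != 0 ->
  exists D A, [/\ A \in unitmx, null_frame (f x) (e x) D,
    (forall u, 'D_u f x = u *m D),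
    (forall u, 'D_u (fun y => - e y) x = u *m (A *m D)) &
    (forall u v,
      second_fundamental_form f x u v =
        lorentz (u *m A *m D) (v *m D) *: f x
        - lorentz (u *m D) (v *m D) *: e x) /\
    (forall u v,
      second_fundamental_form (fun y => - e y) x u v =
        lorentz (u *m A *m D) (v *m A *m D) *: f x
        - lorentz (v *m A *m D) (u *m D) *: e x)].
Proof.
move=> oU Ux fC eC ff ee fe en fpos detA.
have nU : \forall y \near x, U y by exact: open_nbhs_nbhs (conj oU Ux).
have fd y u (Uy : U y) : derivable f y u := (fC 1).1 y Uy u.
have ed y u (Uy : U y) : derivable e y u := (eC 1).1 y Uy u.
have fdd u v : derivable ('D_v f) x u := ((fC 2).2 v).1 x Ux u.
have edd u v : derivable ('D_v e) x u := ((eC 2).2 v).1 x Ux u.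
have Dfe y v : U y -> lorentz ('D_v f y) (e y) = 0.
  by move=> Uy; rewrite lorentzC; exact: en.
have Dff y v : U y -> lorentz ('D_v f y) (f y) = 0.
  by move=> Uy; rewrite lorentzC (lorentz_derive_null oU Uy ff (fd y v Uy)).
have Dee y v : U y -> lorentz ('D_v e y) (e y) = 0.
  by move=> Uy; rewrite lorentzC (lorentz_derive_null oU Uy ee (ed y v Uy)).
have Def y v : U y -> lorentz ('D_v e y) (f y) = 0.
  move=> Uy; apply/eqP; rewrite lorentzC -oppr_eq0.
  by rewrite -(derive_lorentz_cst oU Uy fe (fd _ _ Uy) (ed _ _ Uy)) Dfe.
have [D fD] := C1_differential oU (fC 1) Ux.
have F : null_frame (f x) (e x) D.
  split; [exact: ff|exact: ee|exact: fe|..].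
  - by move=> u; rewrite -fD lorentzC Dff.
  - by move=> u; rewrite -fD lorentzC Dfe.
  - by move=> u /fpos; rewrite /induced_metric fD.
have II u v : second_fundamental_form f x u v =
    lorentz ('D_u ('D_v f) x) (e x) *: f x
    + lorentz ('D_u ('D_v f) x) (f x) *: e x.
  exact: (normal_part_frame _ fD F).
set A := weingarten f x (e x) in detA.
have Au : A \in unitmx by rewrite unitmxE unitfE.
have AE u v : lorentz (u *m A *m D) (v *m D) = lorentz ('D_u ('D_v f) x) (e x).
  have : [set A : 'M[R]_2 | forall u v, induced_metric f x (u *m A) v
      = lorentz (second_fundamental_form f x u v) (e x)] A.
    (* Without any such matrix, A would be the default value 0. *)
    rewrite /A /weingarten; case: xgetP => // noA.
    by move: detA; rewrite /A /weingarten xgetPN ?det0 ?eqxx.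
  move=> /(_ u v); rewrite /induced_metric !fD II => ->.
  by rewrite lorentzDl !lorentzZl ee// fe// mulr1 mulr0 addr0.
have eDA u : 'D_u e x = - (u *m A *m D).
  have [w] := frame_decomposition ('D_u e x) F.
  rewrite Dee// Def// !scale0r !addr0 => wE.
  rewrite wE -mulNmx; apply/eqP; rewrite -subr_eq0 -mulmxBl; apply/eqP.
  rewrite (@frame_nondegenerate (f x) (e x) D (w - - (u *m A)) F) ?mul0mx//.
  move=> v.
  have W := derive_lorentz_cst oU Ux (fun y => Dfe y v) (fdd u v) (ed x u Ux).
  by rewrite opprK mulmxDl lorentzDl -wE AE -fD W [X in _ - X]lorentzC addrN.
have eND u : 'D_u (fun y => - e y) x = u *m (A *m D).
  by rewrite deriveN ?eDA ?opprK ?mulmxA//; exact: ed.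
have eNDD u v : 'D_u ('D_v (fun y => - e y)) x = - 'D_u ('D_v e) x.
  rewrite -(deriveN (edd u v)); apply: near_eq_derive.
  by apply: (filterS _ nU) => y Uy; rewrite deriveN//; exact: ed.
exists D, A; split=> //; split=> u v.
  rewrite II -AE -scaleNr; congr (_ + _ *: _).
  rewrite (derive_lorentz_cst oU Ux (fun y => Dff y v) (fdd u v) (fd x u Ux)).
  by rewrite !fD lorentzC.
rewrite [LHS](normal_part_frame _ eND (frame_mulmx Au F)).
rewrite [flat_connection _ _ _ _]eNDD !lorentzNl.
rewrite (derive_lorentz_cst oU Ux (fun y => Dee y v) (edd u v) (ed x u Ux)).
rewrite (derive_lorentz_cst oU Ux (fun y => Def y v) (edd u v) (fd x u Ux)).
rewrite (eDA u) (eDA v) (fD u) !lorentzNl lorentzNr !opprK scaleNr.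
by rewrite (lorentzC (v *m A *m D) (u *m A *m D)).
Qed.

End NullFrame.

Theorem corollary2p8 (R : realType) (M : smooth_surface R)
    (psi eta : M -> 'rV[R]_4)
    (psi_spacelike : spacelike_immersion psi)
    (psi_cone : forall p, future_lightcone (psi p))
    (eta_transversal : lightlike_transversal psi eta)
    (eta_nondegenerate : nondegenerate_field psi eta) :
  totally_umbilical psi <-> totally_umbilical (conjugated_surface eta).
Proof.
have [[psiS _] psi_pos] := psi_spacelike.
have [[etaS eta_normal] eta_null] := eta_transversal.
have loc c x (ac : atlas c) (cx : chart_img c x) :=
  conjugate_at (@chart_img_open R M c) cx (psiS c ac) (etaS c ac)
    (fun y _ => (psi_cone (chart_inv c y)).1)
    (fun y _ => (eta_null (chart_inv c y)).1)
    (fun y _ => (eta_null (chart_inv c y)).2)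
    (eta_normal c ac) (psi_pos c ac x cx) (eta_nondegenerate c ac x cx).
have conj_spacelike : spacelike_immersion (conjugated_surface eta).
  split; first split.
  - by move=> c ac k; apply: Ck_onN; [exact: chart_img_open|exact: etaS].
  - move=> c ac x cx u; have [D [A [Au F _ eND _]]] := loc c x ac cx.
    rewrite [LHS]eND => uAD.
    apply: (frame_nondegenerate (frame_mulmx Au F)) => v.
    by rewrite uAD lorentz0l.
  - move=> c ac x cx u u0; have [D [A [Au F _ eND _]]] := loc c x ac cx.
    by have := frame_pos (frame_mulmx Au F) u u0; rewrite -eND.
suff pw c x : atlas c -> chart_img c x ->
    (forall u v, second_fundamental_form (psi \o chart_inv c) x u v
      = induced_metric (psi \o chart_inv c) x u v
          *: mean_curvature (psi \o chart_inv c) x) <->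
    (forall u v,
      second_fundamental_form (conjugated_surface eta \o chart_inv c) x u v
      = induced_metric (conjugated_surface eta \o chart_inv c) x u v
          *: mean_curvature (conjugated_surface eta \o chart_inv c) x).
  split=> -[_ H].
    split; first exact: conj_spacelike.
    move=> c ac x cx; exact: (proj1 (pw c x ac cx) (H c ac x cx)).
  split; first exact: psi_spacelike.
  move=> c ac x cx; exact: (proj2 (pw c x ac cx) (H c ac x cx)).
move=> ac cx; have [D [A [Au F fD eND [IIf IIe]]]] := loc c x ac cx.
apply: (iff_trans (umbilical_mean_curvature fD F)).
apply: iff_trans
  (iff_sym (umbilical_mean_curvature eND (frame_mulmx Au F))).
apply: (iff_trans (B := exists2 a, a != 0 & forall u, u *m A = a *: u)).
  apply: iff_trans (umbilical_scalar Au F).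
  by split=> -[k Hk]; exists k => u v; move: (Hk u v);
    rewrite IIf /induced_metric !fD.
apply: (iff_trans (iff_sym (conjugate_umbilical_scalar Au F))).
by split=> -[k Hk]; exists k => u v; move: (Hk u v);
  rewrite [second_fundamental_form _ _ _ _]IIe /induced_metric ?eND !mulmxA.
Qed.
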